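(* Let $q$ be a complex number with $|q|<1$. Then $$\sum_{n=0}^\infty q^{2n(n+1)} (1 + q^{2n+2} - 2q^{4n+3}) \frac{(q^2;q^2)_{n}^3}{(q;q^2)_{n+1}^3 (-1;q)_{2n+3}} = \frac12 \sum_{n=0}^\infty \frac{q^{2n}}{(1-q^{2n+1})^2}$$ and $$\sum_{n=0}^\infty q^{n(n+1)/2} \frac {1-q^{3n+2}} {1-q}\cdot\frac{(q;q)_n^3 (-q;q)_n}{(q^3;q^2)_{n}^3} = (1-q)^2\frac{(q^2;q^2)^4_\infty}{(q;q^2)^4_\infty}.$$
   Context: For $n\in\{0,1,2,\dots\}$ and a complex number $a$, the $q$-shifted factorial is $(a;q)_n=\prod_{k=0}^{n-1}(1-aq^k)$ (with $(a;q)_0=1$), and $(a;q)_\infty=\prod_{k=0}^{\infty}(1-aq^k)$. *)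

(* Defs.v *)
From Stdlib Require Export Reals.
From Coquelicot Require Export Coquelicot.

Open Scope C_scope.

Fixpoint qpoch (a q : C) (n : nat) : C :=
  match n with
  | O => 1
  | S m => qpoch a q m * (1 - a * q ^ m)
  end.

(* The value 0 is allowed, since (a;q)_oo may have a vanishing factor. *)
Definition is_qpoch_inf (a q l : C) : Prop :=
  filterlim (fun n : nat => qpoch a q n) eventually (locally l).

(* Main.v *)
(** Both series are WZ accelerations of Lambert series. If
    [A n k - A (n+1) k = B n k - B n (k+1)] and the pair decays geometrically,
    then [sum_k A 0 k = sum_n B n 0]. One such pair turns
    [sum_k q^(2k) / (1 - q^(2k+1))^2] into the first series of the theorem, and
    another turns [sum_k q^k (1 + q^(2k+1)) / (1 - q^(2k+1))^2] into the second
    one. This last Lambert series is a very-well-poised 6-phi-5 series, and is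
    summed to [(q^2;q^2)_oo^4 / (q;q^2)_oo^4] by a third WZ pair, whose row sums
    are constant and whose rows concentrate on their first term. *)

Require Import Defs.
From Stdlib Require Import Lra Lia.

(** * Bounded families of complex numbers *)

(** The index type is arbitrary so that the same closure lemmas serve sequences and families indexed
    by [nat * nat]. *)
Definition bounded {I : Type} (f : I -> C) : Prop :=
  exists M : R, forall i, (Cmod (f i) <= M)%R.

Lemma bounded_mult {I : Type} (f g : I -> C) :
  bounded f -> bounded g -> bounded (fun i => f i * g i).
Proof.
intros [M hM] [N hN]; exists (M * N)%R; intros i; rewrite Cmod_mult.
apply Rmult_le_compat; auto using Cmod_ge_0.
Qed.

Lemma bounded_plus {I : Type} (f g : I -> C) :
  bounded f -> bounded g -> bounded (fun i => f i + g i).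
Proof.
intros [M hM] [N hN]; exists (M + N)%R; intros i.
eapply Rle_trans; [apply Cmod_triangle |]; apply Rplus_le_compat; auto.
Qed.

Lemma bounded_opp {I : Type} (f : I -> C) :
  bounded f -> bounded (fun i => - f i).
Proof. intros [M hM]; exists M; intros i; rewrite Cmod_opp; auto. Qed.

Lemma bounded_minus {I : Type} (f g : I -> C) :
  bounded f -> bounded g -> bounded (fun i => f i - g i).
Proof.
intros hf hg; apply (bounded_plus f (fun i => - g i)); auto using bounded_opp.
Qed.

Lemma bounded_const {I : Type} (c : C) : bounded (fun _ : I => c).
Proof. exists (Cmod c); intros; apply Rle_refl. Qed.

Lemma bounded_pow {I : Type} (f : I -> C) (m : nat) :
  bounded f -> bounded (fun i => f i ^ m).
Proof.
intros hf; induction m as [|m IH]; simpl;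
  [apply bounded_const | apply (bounded_mult f); assumption].
Qed.

Lemma bounded_comp {I J : Type} (f : J -> C) (e : I -> J) :
  bounded f -> bounded (fun i => f (e i)).
Proof. intros [M hM]; exists M; auto. Qed.

(** WZ components are defined by destructuring a pair; passing to projections exposes the products
    and sums that [solve_bounded] matches on. *)
Lemma bounded_pair (f : nat -> nat -> C) :
  bounded (fun i => f (fst i) (snd i)) ->
  bounded (fun i : nat * nat => let (n, k) := i in f n k).
Proof. intros [M h]; exists M; intros [n k]; apply (h (n, k)). Qed.

(** * Moduli and two-sided bounds for q-shifted factorials *)

Lemma Rpow_le_pow (r : R) (m n : nat) :
  (0 <= r <= 1)%R -> (n <= m)%nat -> (r ^ m <= r ^ n)%R.
Proof.
intros hr hmn; replace m with (n + (m - n))%nat by lia; rewrite pow_add.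
assert (h1 : (0 <= r ^ n)%R) by (apply pow_le; lra).
assert (h2 : (r ^ (m - n) <= 1)%R)
  by (rewrite <- (pow1 (m - n)); apply pow_incr; lra).
assert (h3 := Rmult_le_compat_l _ _ _ h1 h2); lra.
Qed.

Lemma bounded_Cpow {I : Type} (q : C) (e : I -> nat) :
  (Cmod q <= 1)%R -> bounded (fun i => q ^ e i).
Proof.
intros hq; exists 1%R; intros i; rewrite Cmod_pow.
apply (Rpow_le_pow (Cmod q) (e i) 0); [split; [apply Cmod_ge_0 | exact hq] | lia].
Qed.

Lemma Cmod_one_minus_le (z : C) : (Cmod (1 - z) <= 1 + Cmod z)%R.
Proof.
eapply Rle_trans; [apply Cmod_triangle |]; rewrite Cmod_opp, Cmod_1; lra.
Qed.

Lemma Cmod_one_minus_ge (z : C) : (1 - Cmod z <= Cmod (1 - z))%R.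
Proof.
assert (h := Cmod_triangle (1 - z) z).
replace (1 - z + z) with (RtoC 1) in h by ring; rewrite Cmod_1 in h; lra.
Qed.

Lemma one_minus_neq_0 (z : C) : (Cmod z < 1)%R -> 1 - z <> 0.
Proof.
intros hz h; assert (h1 := Cmod_one_minus_ge z).
rewrite h, Cmod_0 in h1; lra.
Qed.

(** With [s = t / (1 - r)], [exp s >= 1 + s], and [(1 - t) * (1 + s) = 1 + t * (r - t) / (1 - r)] is
    at least 1. *)
Lemma exp_neg_le_one_minus (t r : R) :
  (0 <= t <= r)%R -> (r < 1)%R -> (exp (- (t / (1 - r))) <= 1 - t)%R.
Proof.
intros ht hr; rewrite exp_Ropp.
assert (hs : (1 + t / (1 - r) <= exp (t / (1 - r)))%R).
{ destruct (Req_dec t 0) as [-> | ht0].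
  - unfold Rdiv; rewrite Rmult_0_l, exp_0; lra.
  - left; apply exp_ineq1; intros h.
    apply ht0; apply (Rmult_eq_reg_r (/ (1 - r))).
    + unfold Rdiv in h; lra.
    + apply Rinv_neq_0_compat; lra. }
assert (hinv : (1 <= (1 - t) * (1 + t / (1 - r)))%R).
{ replace ((1 - t) * (1 + t / (1 - r)))%R with (1 + t * (r - t) / (1 - r))%R
    by (field; lra).
  assert (0 <= t * (r - t) / (1 - r))%R; [| lra].
  apply Rmult_le_pos; [apply Rmult_le_pos; lra |].
  left; apply Rinv_0_lt_compat; lra. }
assert (h0 := exp_pos (t / (1 - r))).
apply (Rmult_le_reg_r (exp (t / (1 - r)))); [exact h0 |].
rewrite Rinv_l by lra.
eapply Rle_trans; [exact hinv |]; apply Rmult_le_compat_l; lra.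
Qed.

Lemma geometric_partial_sum_le (r : R) (n : nat) :
  (0 <= r < 1)%R ->
  (r * (1 - r ^ n) / (1 - r) <= r / (1 - r))%R.
Proof.
intros hr; unfold Rdiv; apply Rmult_le_compat_r.
- left; apply Rinv_0_lt_compat; lra.
- assert (h : (0 <= r ^ n)%R) by (apply pow_le; lra).
  assert (h' := Rmult_le_pos _ _ (proj1 hr) h); lra.
Qed.

(** The factor of index [k] has modulus between [1 - t] and [1 + t] for [t = r ^ (k + 1)], hence
    between [exp (- (t / (1 - r)))] and [exp t]. The exponents keep the exact partial geometric sum,
    so that the induction closes. *)
Lemma qpoch_exp_bounds (a q : C) (r : R) (n : nat) :
  (Cmod a <= r)%R -> (Cmod q <= r)%R -> (r < 1)%R ->
  (exp (- (r * (1 - r ^ n) / (1 - r) / (1 - r))) <= Cmod (qpoch a q n)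
   <= exp (r * (1 - r ^ n) / (1 - r)))%R.
Proof.
intros ha hq hr; assert (h0 := Cmod_ge_0 a); assert (h1 := Cmod_ge_0 q).
induction n as [|n IH].
- simpl; rewrite Cmod_1.
  replace (r * (1 - 1) / (1 - r))%R with 0%R by (field; lra).
  replace (- (0 / (1 - r)))%R with 0%R by (field; lra); rewrite exp_0; lra.
- simpl qpoch; rewrite Cmod_mult.
  set (t := (r * r ^ n)%R).
  assert (ht : (Cmod (a * q ^ n) <= t)%R).
  { rewrite Cmod_mult, Cmod_pow; apply Rmult_le_compat; auto.
    - apply pow_le; auto.
    - apply pow_incr; auto. }
  assert (htr : (0 <= t <= r)%R).
  { assert (h := Rpow_le_pow r n 0); assert (h' : (0 <= r ^ n)%R)
      by (apply pow_le; lra).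
    unfold t; split; [apply Rmult_le_pos; lra |].
    assert (h'' : (r * r ^ n <= r * 1)%R); [| lra].
    apply Rmult_le_compat_l; [lra |]; apply h; [lra | lia]. }
  assert (hz := Cmod_ge_0 (a * q ^ n)).
  split.
  + replace (- (r * (1 - r ^ S n) / (1 - r) / (1 - r)))%R
      with (- (r * (1 - r ^ n) / (1 - r) / (1 - r)) + - (t / (1 - r)))%R
      by (unfold t; simpl; field; lra).
    rewrite exp_plus; apply Rmult_le_compat; try (left; apply exp_pos).
    * apply IH.
    * eapply Rle_trans; [apply exp_neg_le_one_minus; auto |].
      assert (h := Cmod_one_minus_ge (a * q ^ n)); lra.
  + replace (r * (1 - r ^ S n) / (1 - r))%R
      with (r * (1 - r ^ n) / (1 - r) + t)%R
      by (unfold t; simpl; field; lra).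
    rewrite exp_plus; apply Rmult_le_compat; try apply Cmod_ge_0.
    * apply IH.
    * eapply Rle_trans; [apply Cmod_one_minus_le |].
      eapply Rle_trans; [| apply exp_ineq1_le]; lra.
Qed.

(** The positive lower bound, uniform in [n], is what later bounds the inverses and keeps the
    infinite product away from 0. *)
Lemma qpoch_bounds (a q : C) :
  (Cmod a < 1)%R -> (Cmod q < 1)%R ->
  exists m M : R, (0 < m)%R /\
    forall n, (m <= Cmod (qpoch a q n) <= M)%R.
Proof.
intros ha hq; set (r := Rmax (Cmod a) (Cmod q)).
assert (ha' : (Cmod a <= r)%R) by apply Rmax_l.
assert (hq' : (Cmod q <= r)%R) by apply Rmax_r.
assert (hr : (r < 1)%R) by (apply Rmax_lub_lt; auto).
assert (hr0 : (0 <= r)%R) by (eapply Rle_trans; [apply Cmod_ge_0 | exact ha']).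
exists (exp (- (r / (1 - r) / (1 - r)))), (exp (r / (1 - r))).
split; [apply exp_pos |]; intros n.
destruct (qpoch_exp_bounds a q r n ha' hq' hr) as [h1 h2].
assert (h3 := geometric_partial_sum_le r n (conj hr0 hr)).
assert (hexp : forall x y, (x <= y)%R -> (exp x <= exp y)%R).
{ intros x y [h | ->]; [left; apply exp_increasing; exact h | right; reflexivity]. }
split.
- eapply Rle_trans; [| exact h1]; apply hexp, Ropp_le_contravar.
  apply Rmult_le_compat_r; [left; apply Rinv_0_lt_compat; lra | exact h3].
- eapply Rle_trans; [exact h2 |]; apply hexp, h3.
Qed.

Lemma bounded_qpoch (a q : C) :
  (Cmod a < 1)%R -> (Cmod q < 1)%R -> bounded (qpoch a q).
Proof.
intros ha hq; destruct (qpoch_bounds a q ha hq) as (m & M & _ & h).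
exists M; apply h.
Qed.

Lemma qpoch_neq_0 (a q : C) (n : nat) :
  (Cmod a < 1)%R -> (Cmod q < 1)%R -> qpoch a q n <> 0.
Proof.
intros ha hq hn; destruct (qpoch_bounds a q ha hq) as (m & M & hm & h).
specialize (h n); rewrite hn, Cmod_0 in h; lra.
Qed.

Lemma bounded_inv_qpoch (a q : C) :
  (Cmod a < 1)%R -> (Cmod q < 1)%R -> bounded (fun n => / qpoch a q n).
Proof.
intros ha hq; destruct (qpoch_bounds a q ha hq) as (m & M & hm & h).
exists (/ m)%R; intros n; rewrite Cmod_inv by (apply qpoch_neq_0; auto).
apply Rinv_le_contravar; [exact hm | apply h].
Qed.

Lemma qpoch_S (a q : C) (n : nat) :
  qpoch a q (S n) = qpoch a q n * (1 - a * q ^ n).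
Proof. reflexivity. Qed.

Lemma qpoch_S_l (a q : C) (n : nat) :
  qpoch a q (S n) = (1 - a) * qpoch (a * q) q n.
Proof.
induction n as [|n IH]; [simpl; ring |].
change (qpoch a q (S (S n))) with (qpoch a q (S n) * (1 - a * q ^ S n)).
rewrite IH; simpl; ring.
Qed.

(** * Limits of complex sequences *)

Lemma Clim_iff (u : nat -> C) (l : C) :
  filterlim u eventually (locally l) <->
  forall eps : R, (0 < eps)%R ->
    exists N, forall n, (N <= n)%nat -> (Cmod (u n - l) < eps)%R.
Proof.
split.
- intros h eps heps.
  destruct (proj1 (filterlim_locally_ball_norm u l) h (mkposreal eps heps))
    as [N hN].
  exists N; intros n hn; exact (hN n hn).
- intros h; apply (proj2 (@filterlim_locally_ball_norm C_AbsRing nat C_NormedModule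
    eventually _ u l)); intros eps.
  destruct (h eps (cond_pos eps)) as [N hN]; exists N; exact hN.
Qed.

Lemma Clim_unique (u : nat -> C) (l l' : C) :
  filterlim u eventually (locally l) -> filterlim u eventually (locally l') ->
  l = l'.
Proof. 
apply (@filterlim_locally_unique nat C_AbsRing C_NormedModule eventually _ u).
Qed.

Lemma Clim_const (c : C) : filterlim (fun _ : nat => c) eventually (locally c).
Proof. apply filterlim_const. Qed.

Lemma Clim_plus (u v : nat -> C) (l l' : C) :
  filterlim u eventually (locally l) -> filterlim v eventually (locally l') ->
  filterlim (fun n => u n + v n) eventually (locally (l + l')).
Proof.
intros hu hv; eapply filterlim_comp_2; [exact hu | exact hv |].
apply (@filterlim_plus C_AbsRing C_NormedModule).
Qed.

Lemma Clim_minus (u v : nat -> C) (l l' : C) :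
  filterlim u eventually (locally l) -> filterlim v eventually (locally l') ->
  filterlim (fun n => u n - v n) eventually (locally (l - l')).
Proof.
intros hu hv; apply (Clim_plus u (fun n => - v n)); [exact hu |].
eapply filterlim_comp; [exact hv |].
apply (@filterlim_opp C_AbsRing C_NormedModule).
Qed.

Lemma Clim_bounded (u : nat -> C) (l : C) :
  filterlim u eventually (locally l) ->
  exists M : R, (0 < M)%R /\ exists N, forall n, (N <= n)%nat -> (Cmod (u n) <= M)%R.
Proof.
intros hu; destruct (proj1 (Clim_iff u l) hu 1%R Rlt_0_1) as [N hN].
exists (Cmod l + 1)%R; split; [assert (h := Cmod_ge_0 l); lra |].
exists N; intros n hn.
assert (h := Cmod_triangle (u n - l) l); specialize (hN n hn).
replace (u n - l + l) with (u n) in h by ring; lra.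
Qed.

Lemma Clim_mult (u v : nat -> C) (l l' : C) :
  filterlim u eventually (locally l) -> filterlim v eventually (locally l') ->
  filterlim (fun n => u n * v n) eventually (locally (l * l')).
Proof.
intros hu hv.
destruct (Clim_bounded v l' hv) as (M & hM & N0 & hN0).
apply Clim_iff; intros eps heps.
assert (hl := Cmod_ge_0 l).
destruct (proj1 (Clim_iff u l) hu (eps / 2 / M)%R) as [N1 hN1].
{ apply Rdiv_lt_0_compat; lra. }
destruct (proj1 (Clim_iff v l') hv (eps / 2 / (Cmod l + 1))%R) as [N2 hN2].
{ apply Rdiv_lt_0_compat; lra. }
exists (N0 + N1 + N2)%nat; intros n hn.
replace (u n * v n - l * l') with ((u n - l) * v n + l * (v n - l')) by ring.
eapply Rle_lt_trans; [apply Cmod_triangle |]; rewrite !Cmod_mult.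
specialize (hN0 n ltac:(lia)); specialize (hN1 n ltac:(lia)).
specialize (hN2 n ltac:(lia)).
assert (h1 : (Cmod (u n - l) * Cmod (v n) <= Cmod (u n - l) * M)%R)
  by (apply Rmult_le_compat_l; [apply Cmod_ge_0 | exact hN0]).
assert (h2 : (Cmod (u n - l) * M < eps / 2)%R).
{ apply (Rmult_lt_compat_r M) in hN1; [| exact hM].
  replace (eps / 2 / M * M)%R with (eps / 2)%R in hN1 by (field; lra); lra. }
assert (h3 : (Cmod l * Cmod (v n - l') <= eps / 2)%R).
{ apply Rle_trans with ((Cmod l + 1) * (eps / 2 / (Cmod l + 1)))%R.
  - apply Rmult_le_compat; auto using Cmod_ge_0; lra.
  - right; field; lra. }
lra.
Qed.

Lemma Clim_pow (u : nat -> C) (l : C) (m : nat) :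
  filterlim u eventually (locally l) ->
  filterlim (fun n => u n ^ m) eventually (locally (l ^ m)).
Proof.
intros hu; induction m as [|m IH]; simpl;
  [apply Clim_const | apply Clim_mult; assumption].
Qed.

Lemma Clim_shift (u : nat -> C) (l : C) :
  filterlim (fun n => u (S n)) eventually (locally l) <->
  filterlim u eventually (locally l).
Proof.
split; intros h P hP; destruct (h P hP) as [N hN].
- exists (S N); intros [|n] hn; [lia | apply hN; lia].
- exists N; intros n hn; apply hN; lia.
Qed.

Lemma Clim_geometric (u : nat -> C) (l : C) (c r : R) :
  (0 <= r < 1)%R -> (forall n, Cmod (u n - l) <= c * r ^ n)%R ->
  filterlim u eventually (locally l).
Proof.
intros hr h; apply Clim_iff; intros eps heps.
assert (hc : (0 <= c)%R).
{ specialize (h O); simpl in h; assert (h' := Cmod_ge_0 (u O - l)); lra. }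
(* Dividing by [c + 1] instead of [c] covers the case [c = 0]. *)
destruct (pow_lt_1_zero r ltac:(rewrite Rabs_pos_eq; lra) (eps / (c + 1))%R)
  as [N hN].
{ apply Rdiv_lt_0_compat; lra. }
exists N; intros n hn; eapply Rle_lt_trans; [apply h |].
specialize (hN n hn); rewrite Rabs_pos_eq in hN by (apply pow_le; lra).
apply Rle_lt_trans with ((c + 1) * r ^ n)%R.
- apply Rmult_le_compat_r; [apply pow_le; lra | lra].
- apply (Rmult_lt_compat_l (c + 1)) in hN; [| lra].
  replace ((c + 1) * (eps / (c + 1)))%R with eps in hN by (field; lra); lra.
Qed.

(** * Complex series with geometric majorants, and infinite products *)

Lemma Cseries_ext (a b : nat -> C) (s : C) :
  (forall n, a n = b n) -> is_series a s -> is_series b s.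
Proof. apply is_series_ext. Qed.

Lemma Cseries_scal (c : C) (a : nat -> C) (s : C) :
  is_series a s -> is_series (fun n => c * a n) (c * s).
Proof. apply (is_series_scal c a s). Qed.

Lemma ex_series_geometric_bound (a : nat -> C) (c r : R) :
  (0 <= r < 1)%R -> (forall n, Cmod (a n) <= c * r ^ n)%R ->
  exists s : C, is_series a s /\ (Cmod s <= c / (1 - r))%R.
Proof.
intros hr h.
assert (hg : is_series (fun n => c * r ^ n)%R (c / (1 - r))%R).
{ apply (is_series_scal_l c (fun n => r ^ n)%R (/ (1 - r))%R).
  apply is_series_geom; rewrite Rabs_pos_eq; lra. }
destruct (@ex_series_le C_AbsRing C_CompleteNormedModule a
            (fun n => c * r ^ n)%R h) as [s hs].
{ eexists; exact hg. }
exists s; split; [exact hs |].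
assert (hn : is_lim_seq (fun n => Cmod (sum_n a n)) (Cmod s)).
{ apply (filterlim_comp _ _ _ (fun n => sum_n a n) Cmod _ _ _ hs).
  apply (@filterlim_norm C_AbsRing C_NormedModule). }
refine (is_lim_seq_le _ (fun n => sum_n (fun n => c * r ^ n)%R n) _
          (c / (1 - r))%R _ hn hg).
intros n; induction n as [|n IH].
- rewrite !sum_O; apply h.
- rewrite !sum_Sn; eapply Rle_trans; [apply Cmod_triangle |].
  apply Rplus_le_compat; [exact IH | apply h].
Qed.

Lemma ex_Clim_geometric_increments (u : nat -> C) (c r : R) :
  (0 <= r < 1)%R -> (forall n, Cmod (u (S n) - u n) <= c * r ^ n)%R ->
  exists l : C, filterlim u eventually (locally l).
Proof.
intros hr h.
destruct (ex_series_geometric_bound (fun n => u (S n) - u n) c r hr h)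
  as (s & hs & _).
exists (s + u O); apply Clim_shift.
apply (filterlim_ext (fun n => sum_n (fun n => u (S n) - u n) n + u O)).
- intros n; induction n as [|n IH].
  + rewrite sum_O; ring.
  + rewrite sum_Sn; change plus with Cplus.
    rewrite <- IH; ring.
- apply Clim_plus; [exact hs | apply Clim_const].
Qed.

(** Consecutive partial products differ by [- (qpoch a q n * a * q ^ n)], which decays
    geometrically; the uniform lower bound on the partial products excludes the limit 0. *)
Lemma ex_qpoch_inf (a q : C) :
  (Cmod a < 1)%R -> (Cmod q < 1)%R ->
  exists l, is_qpoch_inf a q l /\ l <> 0.
Proof.
intros ha hq; destruct (qpoch_bounds a q ha hq) as (m & M & hm & h).
assert (h0 := Cmod_ge_0 a); assert (h1 := Cmod_ge_0 q).
destruct (ex_Clim_geometric_increments (qpoch a q) M (Cmod q)) as [l hl].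
- split; auto.
- intros n; replace (qpoch a q (S n) - qpoch a q n)
    with (- (qpoch a q n * a * q ^ n)) by (simpl; ring).
  rewrite Cmod_opp, !Cmod_mult, Cmod_pow.
  apply Rmult_le_compat_r; [apply pow_le; auto |].
  destruct (h n) as [h2 h3].
  rewrite <- (Rmult_1_r M); apply Rmult_le_compat; auto using Cmod_ge_0; lra.
- exists l; split; [exact hl |]; intros ->.
  destruct (proj1 (Clim_iff _ _) hl m hm) as [N hN].
  specialize (hN N (Nat.le_refl N)); destruct (h N) as [h2 _].
  replace (qpoch a q N - 0) with (qpoch a q N) in hN by ring; lra.
Qed.

(** * Telescoping and WZ acceleration *)

Lemma telescoping_step (A A' B : nat -> C) (s s' : C) :
  (forall k, A k - A' k = B k - B (S k)) ->
  is_series A s -> is_series A' s' ->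
  filterlim B eventually (locally (RtoC 0)) ->
  s - s' = B O.
Proof.
intros hAB hs hs' hB.
apply (Clim_unique (fun K => sum_n A K - sum_n A' K));
  [apply Clim_minus; assumption |].
apply (filterlim_ext (fun K => B O - B (S K))).
- intros K; induction K as [|K IH].
  + rewrite !sum_O; symmetry; apply hAB.
  + rewrite !sum_Sn; change plus with Cplus.
    replace (sum_n A K + A (S K) - (sum_n A' K + A' (S K)))
      with ((sum_n A K - sum_n A' K) + (A (S K) - A' (S K))) by ring.
    rewrite <- IH, hAB; ring.
- assert (h : filterlim (fun K => B O - B (S K)) eventually
                (locally (B O - 0))).
  { apply Clim_minus; [apply Clim_const | apply Clim_shift; exact hB]. }
  replace (B O - 0) with (B O) in h by ring; exact h.
Qed.

(* The WZ acceleration principle: the total of each row drops by [B n 0] from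
   row [n] to row [S n], and the row totals tend to 0. *)
Lemma wz_acceleration (A B : nat -> nat -> C) (c r : R) :
  (0 <= r < 1)%R ->
  (forall n k, A n k - A (S n) k = B n k - B n (S k)) ->
  (forall n k, Cmod (A n k) <= c * r ^ n * r ^ k)%R ->
  (forall n k, Cmod (B n k) <= c * r ^ n * r ^ k)%R ->
  exists s : C, is_series (A O) s /\ is_series (fun n => B n O) s.
Proof.
intros hr hAB hA hB'.
assert (hB : forall n, filterlim (B n) eventually (locally (RtoC 0))).
{ intros n; apply (Clim_geometric _ _ (c * r ^ n) r hr); intros k.
  replace (B n k - 0) with (B n k) by ring; apply hB'. }
destruct (ex_series_geometric_bound (A O) (c * r ^ 0) r hr (hA O))
  as (s & hs & _).
exists s; split; [exact hs |].
(* [sum_n _ N] contains the terms 0 to [N], so the error is the total of row [N + 1], at most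
   [c * r ^ (N + 1) / (1 - r)]; hence the extra factor [r]. *)
apply (Clim_geometric _ _ (c / (1 - r) * r) r hr); intros N.
assert (hN : exists t, is_series (A (S N)) t /\
   (Cmod t <= c * r ^ S N / (1 - r))%R /\ s - t = sum_n (fun n => B n O) N).
{ induction N as [|N (t & ht & _ & IH)].
  - destruct (ex_series_geometric_bound (A 1%nat) (c * r ^ 1) r hr (hA 1%nat))
      as (t & ht & hb).
    exists t; repeat split; auto; rewrite sum_O.
    apply (telescoping_step (A O) (A 1%nat) (B O)); auto.
  - destruct (ex_series_geometric_bound (A (S (S N))) (c * r ^ S (S N)) r hr
                (hA (S (S N)))) as (t' & ht' & hb).
    exists t'; repeat split; auto; rewrite sum_Sn, <- IH.
    change plus with Cplus.
    rewrite <- (telescoping_step (A (S N)) (A (S (S N))) (B (S N)) t t'); auto.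
    ring. }
destruct hN as (t & _ & hb & ht).
enough (h : (Cmod (s - t - s) <= c / (1 - r) * r * r ^ N)%R)
  by (rewrite ht in h; exact h).
replace (s - t - s) with (- t) by ring; rewrite Cmod_opp.
eapply Rle_trans; [exact hb |]; right; simpl; field; lra.
Qed.

(** Here [-1] lies on the unit circle, outside the range of [qpoch_bounds]. Splitting off the first
    factor, equal to 2, leaves a factorial with parameter [-q]. *)
Lemma bounded_inv_qpoch_m1 (q : C) :
  (Cmod q < 1)%R -> bounded (fun n => / qpoch (- (1)) q n).
Proof.
intros hq; assert (hq' : (Cmod (- (1) * q) < 1)%R).
{ replace (- (1) * q) with (- q) by ring; rewrite Cmod_opp; exact hq. }
destruct (qpoch_bounds (- (1) * q) q hq' hq) as (m & M & hm & h).
assert (hm' : (0 < / m)%R) by (apply Rinv_0_lt_compat; exact hm).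
exists (1 + / m)%R; intros [|n].
- simpl; replace (/ 1) with (RtoC 1) by (field; apply C1_nz).
  rewrite Cmod_1; lra.
- rewrite qpoch_S_l; set (x := qpoch _ _ _).
  replace ((1 - - (1)) * x) with (2 * x) by ring.
  assert (hx : (m <= Cmod (2 * x))%R).
  { rewrite Cmod_mult, Cmod_R, Rabs_pos_eq by lra.
    destruct (h n) as [h1 _]; unfold x; lra. }
  rewrite Cmod_inv by (apply Cmod_gt_0; lra).
  apply Rle_trans with (/ m)%R; [apply Rinv_le_contravar; lra | lra].
Qed.

(** The power of [q] alone supplies the decay. Nonnegativity of [c] is recorded so that the
    constants of the two halves of a WZ pair can be added into a common one. *)
Lemma geometric_of_bounded (q : C) (H : nat * nat -> C) (e : nat -> nat -> nat) :
  (Cmod q < 1)%R -> bounded H -> (forall n k, n + k <= e n k)%nat ->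
  exists c, (0 <= c)%R /\
    forall n k,
      (Cmod (q ^ e n k * H (n, k)) <= c * Cmod q ^ n * Cmod q ^ k)%R.
Proof.
intros hq [c hc] he; assert (h0 := Cmod_ge_0 q); exists c; split.
{ eapply Rle_trans; [apply Cmod_ge_0 | apply (hc (0, 0)%nat)]. }
intros n k; rewrite Cmod_mult, Cmod_pow, Rmult_assoc, <- pow_add, Rmult_comm.
apply Rmult_le_compat; auto using Cmod_ge_0.
- apply pow_le; exact h0.
- apply Rpow_le_pow; [lra | apply he].
Qed.

Lemma wz_acceleration_bounded (q : C) (e : nat -> nat -> nat)
    (HA HB : nat * nat -> C) :
  (Cmod q < 1)%R -> bounded HA -> bounded HB ->
  (forall n k, n + k <= e n k)%nat ->
  (forall n k,
     q ^ e n k * HA (n, k) - q ^ e (S n) k * HA (S n, k) =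
     q ^ e n k * HB (n, k) - q ^ e n (S k) * HB (n, S k)) ->
  exists s : C,
    is_series (fun k => q ^ e O k * HA (O, k)) s /\
    is_series (fun n => q ^ e n O * HB (n, O)) s.
Proof.
intros hq bA bB he hAB; assert (h0 := Cmod_ge_0 q).
destruct (geometric_of_bounded q HA e hq bA he) as (c & hc0 & hc).
destruct (geometric_of_bounded q HB e hq bB he) as (d & hd0 & hd).
assert (hp : forall n k, (0 <= Cmod q ^ n * Cmod q ^ k)%R)
  by (intros; apply Rmult_le_pos; apply pow_le; exact h0).
apply (wz_acceleration (fun n k => q ^ e n k * HA (n, k))
         (fun n k => q ^ e n k * HB (n, k)) (c + d) (Cmod q)); auto.
- intros n k; eapply Rle_trans; [apply hc |]; rewrite !Rmult_assoc.
  apply Rmult_le_compat_r; [apply hp | lra].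
- intros n k; eapply Rle_trans; [apply hd |]; rewrite !Rmult_assoc.
  apply Rmult_le_compat_r; [apply hp | lra].
Qed.

(** * Nonvanishing factors and factorials in base [q ^ 2] *)

Lemma Cmod_pow_lt_1 (q : C) (n : nat) :
  (Cmod q < 1)%R -> (Cmod (q ^ S n) < 1)%R.
Proof.
intros hq; rewrite Cmod_pow; assert (h0 := Cmod_ge_0 q).
apply Rle_lt_trans with (Cmod q ^ 1)%R.
- apply Rpow_le_pow; [lra | lia].
- rewrite pow_1; exact hq.
Qed.

Lemma one_minus_pow_neq_0 (q : C) (n : nat) :
  (Cmod q < 1)%R -> 1 - q ^ S n <> 0.
Proof. intros hq; apply one_minus_neq_0, Cmod_pow_lt_1, hq. Qed.

Lemma one_plus_pow_neq_0 (q : C) (n : nat) :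
  (Cmod q < 1)%R -> 1 + q ^ S n <> 0.
Proof.
intros hq; replace (1 + q ^ S n) with (1 - - q ^ S n) by ring.
apply one_minus_neq_0; rewrite Cmod_opp; apply Cmod_pow_lt_1, hq.
Qed.

Definition evenp (q : C) (n : nat) : C := qpoch (q ^ 2) (q ^ 2) n.
Definition oddp (q : C) (n : nat) : C := qpoch q (q ^ 2) n.

Lemma Cpow_sqr (q : C) (n : nat) : (q ^ 2) ^ n = q ^ n * q ^ n.
Proof.
rewrite <- Cpow_mult_r, <- Cpow_add_r; f_equal; lia.
Qed.

(** The new factor is written as a polynomial in [q] and [q ^ n], the form in which [field] can
    treat [q ^ n] as an atom. *)
Lemma evenp_S (q : C) (n : nat) :
  evenp q (S n) = evenp q n * (1 - q ^ 2 * (q ^ n) ^ 2).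
Proof. unfold evenp; rewrite qpoch_S, Cpow_sqr; ring. Qed.

Lemma oddp_S (q : C) (n : nat) :
  oddp q (S n) = oddp q n * (1 - q * (q ^ n) ^ 2).
Proof. unfold oddp; rewrite qpoch_S, Cpow_sqr; ring. Qed.

Lemma bounded_evenp (q : C) : (Cmod q < 1)%R -> bounded (evenp q).
Proof. intros; apply bounded_qpoch; apply Cmod_pow_lt_1; assumption. Qed.

Lemma bounded_inv_evenp (q : C) :
  (Cmod q < 1)%R -> bounded (fun n => / evenp q n).
Proof. intros; apply bounded_inv_qpoch; apply Cmod_pow_lt_1; assumption. Qed.

Lemma bounded_oddp (q : C) : (Cmod q < 1)%R -> bounded (oddp q).
Proof. intros; apply bounded_qpoch; [| apply Cmod_pow_lt_1]; assumption. Qed.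

Lemma bounded_inv_oddp (q : C) :
  (Cmod q < 1)%R -> bounded (fun n => / oddp q n).
Proof. intros; apply bounded_inv_qpoch; [| apply Cmod_pow_lt_1]; assumption. Qed.

Lemma evenp_neq_0 (q : C) (n : nat) : (Cmod q < 1)%R -> evenp q n <> 0.
Proof. intros; apply qpoch_neq_0; apply Cmod_pow_lt_1; assumption. Qed.

Lemma oddp_neq_0 (q : C) (n : nat) : (Cmod q < 1)%R -> oddp q n <> 0.
Proof. intros; apply qpoch_neq_0; [| apply Cmod_pow_lt_1]; assumption. Qed.

Lemma qpoch_m1_neq_0 (q : C) (n : nat) :
  (Cmod q < 1)%R -> qpoch (- (1)) q n <> 0.
Proof.
intros hq; destruct n as [|n]; [apply C1_nz |]; rewrite qpoch_S_l.
apply Cmult_neq_0.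
- replace (1 - - (1)) with (RtoC 2) by ring.
  intros h; apply RtoC_inj in h; lra.
- apply qpoch_neq_0; [| exact hq].
  replace (- (1) * q) with (- q) by ring; rewrite Cmod_opp; exact hq.
Qed.

(** * Automation for boundedness and nonvanishing *)

(** Recursion on the shape of the expression. A power is first tried as [q] to a varying exponent,
    bounded because [q] lies in the unit disc, and otherwise as a fixed power of a bounded
    family. *)
Ltac solve_bounded :=
  lazymatch goal with
  | |- bounded (fun _ => ?c) => apply (bounded_const c)
  | |- bounded (fun i => @?f i * @?g i) =>
      apply (bounded_mult f g); solve_bounded
  | |- bounded (fun i => @?f i + @?g i) =>
      apply (bounded_plus f g); solve_bounded
  | |- bounded (fun i => @?f i - @?g i) =>
      apply (bounded_minus f g); solve_bounded
  | |- bounded (fun i => @?f i ^ @?e i) =>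
      first [apply bounded_Cpow; lra | apply bounded_pow; solve_bounded]
  | |- bounded (fun i => / evenp ?q (@?e i)) =>
      apply (bounded_comp (fun n => / evenp q n) e), bounded_inv_evenp; auto
  | |- bounded (fun i => / oddp ?q (@?e i)) =>
      apply (bounded_comp (fun n => / oddp q n) e), bounded_inv_oddp; auto
  | |- bounded (fun i => / qpoch ?a ?q (@?e i)) =>
      apply (bounded_comp (fun n => / qpoch a q n) e),
        bounded_inv_qpoch_m1; auto
  | |- bounded (fun i => ?f (@?e i)) =>
      apply (bounded_comp f e);
      first [apply bounded_evenp | apply bounded_oddp | apply bounded_qpoch];
      rewrite ?Cmod_opp; assumption
  end.

(** Backtracks over the disequalities in context until one concerns the same expression up to
    [ring]. *)
Ltac solve_neq_0 :=
  cbv beta;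
  match goal with
  | h : ?x <> _ |- ?y <> _ =>
      let e := fresh in intros e; apply h; rewrite <- e; ring
  end.

(** * The WZ pair for the first series *)

(* Here and below, [wz<i>_A] and [wz<i>_B] are the bounded parts of a WZ pair:
   the pair itself is obtained by multiplying both by one power of [q], chosen
   with nonnegative exponent so that [q = 0] needs no separate treatment. *)
Definition wz1_A (q : C) (i : nat * nat) : C :=
  let (n, k) := i in
  evenp q n ^ 3 * / oddp q (S n) * / qpoch (- (1)) q (2 * n + 3) *
  ((1 + q ^ (2 * n + 2)) * (1 - q ^ (4 * n + 2))) *
  (oddp q k * / oddp q (S (n + k))) ^ 2.

Definition wz1_B (q : C) (i : nat * nat) : C :=
  let (n, k) := i in
  evenp q n ^ 3 * / oddp q (S n) * / qpoch (- (1)) q (2 * n + 3) *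
  (1 + q ^ (2 * n + 2) - 2 * q ^ (2 * k + 4 * n + 3)) *
  (oddp q k * / oddp q (S (n + k))) ^ 2.

Lemma bounded_wz1_A (q : C) : (Cmod q < 1)%R -> bounded (wz1_A q).
Proof. intros hq; apply bounded_pair; solve_bounded. Qed.

Lemma bounded_wz1_B (q : C) : (Cmod q < 1)%R -> bounded (wz1_B q).
Proof. intros hq; apply bounded_pair; solve_bounded. Qed.

(** Once every factorial is reduced to a common base index and every power of [q] is split, the
    relation is an identity of rational functions in [q], [v = q ^ n] and [w = q ^ k], with
    [z = q ^ e n k] a common factor. *)
Lemma wz_pair1 (q : C) (n k : nat) : (Cmod q < 1)%R ->
  let e n k := (2 * n * (n + 1) + 2 * k * (2 * n + 1))%nat in
  q ^ e n k * wz1_A q (n, k) - q ^ e (S n) k * wz1_A q (S n, k) =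
  q ^ e n k * wz1_B q (n, k) - q ^ e n (S k) * wz1_B q (n, S k).
Proof.
intros hq e; unfold wz1_A, wz1_B.
(* Exponents are spelled out as sums of [n], [k] and a numeral, so that [Cpow_add_r] reduces each
   power to [z], [v], [w] and powers of [q]. *)
replace (e (S n) k) with (e n k + n + n + n + n + k + k + k + k + 4)%nat
  by (unfold e; lia).
replace (e n (S k)) with (e n k + n + n + n + n + 2)%nat by (unfold e; lia).
replace (n + S k)%nat with (S (n + k)) by lia.
replace (S n + k)%nat with (S (n + k)) by lia.
replace (2 * S n + 3)%nat with (S (S (2 * n + 3))) by lia.
rewrite !qpoch_S, !(oddp_S q (S _)), (oddp_S q k), (evenp_S q n).
replace (S (2 * n + 3))%nat with (n + n + 4)%nat by lia.
replace (2 * S n + 2)%nat with (n + n + 4)%nat by lia.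
replace (4 * S n + 2)%nat with (n + n + n + n + 6)%nat by lia.
replace (4 * n + 2)%nat with (n + n + n + n + 2)%nat by lia.
replace (2 * n + 2)%nat with (n + n + 2)%nat by lia.
replace (2 * k + 4 * n + 3)%nat with (k + k + n + n + n + n + 3)%nat by lia.
replace (2 * S k + 4 * n + 3)%nat with (k + k + n + n + n + n + 5)%nat by lia.
assert (hN := qpoch_m1_neq_0 q (2 * n + 3) hq).
set (N := qpoch (- (1)) q (2 * n + 3)) in *.
replace (2 * n + 3)%nat with (n + n + 3)%nat by lia.
(* These are the denominators created by passing to row [n + 1] or column [k + 1]; each index is one
   less than the exponent of [q], since the lemmas speak of [q ^ S n]. *)
assert (h1 := one_minus_pow_neq_0 q (n + n + 2) hq).
assert (h2 := one_plus_pow_neq_0 q (n + n + 2) hq).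
assert (h3 := one_plus_pow_neq_0 q (n + n + 3) hq).
assert (h4 := one_minus_pow_neq_0 q (n + n + k + k + 2) hq).
assert (ho := oddp_neq_0 q (S n) hq).
assert (hg := oddp_neq_0 q (S (n + k)) hq).
rewrite !Cpow_S, !Cpow_add_r in h1.
rewrite !Cpow_S, !Cpow_add_r in h2.
rewrite !Cpow_S, !Cpow_add_r in h3.
rewrite !Cpow_S, !Cpow_add_r in h4.
rewrite !Cpow_S, !Cpow_add_r.
set (o := oddp q (S n)) in *; set (g := oddp q (S (n + k))) in *.
set (f := oddp q k); set (ev := evenp q n).
set (z := q ^ e n k); set (v := q ^ n) in *; set (w := q ^ k) in *.
clearbody z f ev o g N v w; simpl in *.
field; repeat split; solve_neq_0.
Qed.

(** * The WZ pair for the second series *)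

Definition wz2_A (q : C) (i : nat * nat) : C :=
  let (n, k) := i in
  qpoch q q n ^ 3 * qpoch (- q) q n * / oddp q (S n) *
  ((1 - q ^ (2 * n + 1)) * (1 + q ^ (2 * k + 1 + n))) *
  (oddp q k * / oddp q (S (n + k))) ^ 2.

Definition wz2_B (q : C) (i : nat * nat) : C :=
  let (n, k) := i in
  qpoch q q n ^ 3 * qpoch (- q) q n * / oddp q (S n) *
  (1 - q ^ (2 * k + 3 * n + 2)) *
  (oddp q k * / oddp q (S (n + k))) ^ 2.

Lemma bounded_wz2_A (q : C) : (Cmod q < 1)%R -> bounded (wz2_A q).
Proof. intros hq; apply bounded_pair; solve_bounded. Qed.

Lemma bounded_wz2_B (q : C) : (Cmod q < 1)%R -> bounded (wz2_B q).
Proof. intros hq; apply bounded_pair; solve_bounded. Qed.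

Lemma triangular_S (n : nat) :
  (S n * (S n + 1) / 2 = n * (n + 1) / 2 + n + 1)%nat.
Proof.
(* The numerator grows by a multiple of 2, which passes through truncated division without a parity
   argument. *)
replace (S n * (S n + 1))%nat with (n * (n + 1) + (n + 1) * 2)%nat by lia.
rewrite Nat.div_add by lia; lia.
Qed.

Lemma triangular_ge (n : nat) : (n <= n * (n + 1) / 2)%nat.
Proof.
induction n as [|n IH]; [apply Nat.le_0_l | rewrite triangular_S; lia].
Qed.

Lemma wz_pair2 (q : C) (n k : nat) : (Cmod q < 1)%R ->
  let e n k := (n * (n + 1) / 2 + k * (2 * n + 1))%nat in
  q ^ e n k * wz2_A q (n, k) - q ^ e (S n) k * wz2_A q (S n, k) =
  q ^ e n k * wz2_B q (n, k) - q ^ e n (S k) * wz2_B q (n, S k).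
Proof.
intros hq e; unfold wz2_A, wz2_B.
replace (e (S n) k) with (e n k + n + k + k + 1)%nat
  by (unfold e; rewrite triangular_S; lia).
replace (e n (S k)) with (e n k + n + n + 1)%nat by (unfold e; lia).
replace (n + S k)%nat with (S (n + k)) by lia.
replace (S n + k)%nat with (S (n + k)) by lia.
rewrite !qpoch_S, !(oddp_S q (S _)), (oddp_S q k).
replace (2 * S n + 1)%nat with (n + n + 3)%nat by lia.
replace (2 * n + 1)%nat with (n + n + 1)%nat by lia.
replace (2 * k + 1 + n)%nat with (k + k + n + 1)%nat by lia.
replace (2 * k + 1 + S n)%nat with (k + k + n + 2)%nat by lia.
replace (2 * k + 3 * n + 2)%nat with (k + k + n + n + n + 2)%nat by lia.
replace (2 * S k + 3 * n + 2)%nat with (k + k + n + n + n + 4)%nat by lia.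
assert (h1 := one_minus_pow_neq_0 q (n + n + 2) hq).
assert (h4 := one_minus_pow_neq_0 q (n + n + k + k + 2) hq).
assert (ho := oddp_neq_0 q (S n) hq).
assert (hg := oddp_neq_0 q (S (n + k)) hq).
rewrite !Cpow_S, !Cpow_add_r in h1.
rewrite !Cpow_S, !Cpow_add_r in h4.
rewrite !Cpow_S, !Cpow_add_r.
set (o := oddp q (S n)) in *; set (g := oddp q (S (n + k))) in *.
set (f := oddp q k); set (x := qpoch q q n); set (y := qpoch (- q) q n).
set (z := q ^ e n k); set (v := q ^ n) in *; set (w := q ^ k) in *.
clearbody z f x y o g v w; simpl in *.
field; repeat split; solve_neq_0.
Qed.

(** * The WZ pair for the 6-phi-5 sum *)

Definition wz3_A (q : C) (i : nat * nat) : C :=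
  let (m, n) := i in
  (1 - q ^ (4 * n + 2 + 2 * m)) *
  (evenp q m ^ 3 * evenp q (m + n) * oddp q n ^ 3 *
   (/ evenp q n * (/ oddp q (S (m + n))) ^ 3 * / oddp q m)).

(** The factor [1 - q ^ (2 * n)] vanishes at [n = 0]: no boundary term is left when a row
    telescopes, so the row sums do not depend on [m]. *)
Definition wz3_B (q : C) (i : nat * nat) : C :=
  let (m, n) := i in
  (1 - q ^ (2 * n)) * (1 - q ^ (2 * n + 3 + 4 * m)) *
  (evenp q m ^ 3 * evenp q (m + n) * oddp q n ^ 3 *
   (/ evenp q n * (/ oddp q (S (m + n))) ^ 3 * / oddp q (S m))).

Lemma bounded_wz3_A (q : C) : (Cmod q < 1)%R -> bounded (wz3_A q).
Proof. intros hq; apply bounded_pair; solve_bounded. Qed.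

Lemma bounded_wz3_B (q : C) : (Cmod q < 1)%R -> bounded (wz3_B q).
Proof. intros hq; apply bounded_pair; solve_bounded. Qed.

Lemma wz_pair3 (q : C) (m n : nat) : (Cmod q < 1)%R ->
  q ^ (n * (2 * m + 1)) * wz3_A q (m, n) -
    q ^ (n * (2 * S m + 1)) * wz3_A q (S m, n) =
  q ^ (n * (2 * m + 1)) * wz3_B q (m, n) -
    q ^ (S n * (2 * m + 1)) * wz3_B q (m, S n).
Proof.
intros hq; unfold wz3_A, wz3_B.
replace (n * (2 * S m + 1))%nat with (n * (2 * m + 1) + n + n)%nat by lia.
replace (S n * (2 * m + 1))%nat with (n * (2 * m + 1) + m + m + 1)%nat by lia.
replace (m + S n)%nat with (S (m + n)) by lia.
replace (S m + n)%nat with (S (m + n)) by lia.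
rewrite (oddp_S q (S _)), (oddp_S q m), (oddp_S q n), !evenp_S.
replace (4 * n + 2 + 2 * m)%nat with (n + n + n + n + m + m + 2)%nat by lia.
replace (4 * n + 2 + 2 * S m)%nat with (n + n + n + n + m + m + 4)%nat by lia.
replace (2 * n + 3 + 4 * m)%nat with (n + n + m + m + m + m + 3)%nat by lia.
replace (2 * S n + 3 + 4 * m)%nat with (n + n + m + m + m + m + 5)%nat by lia.
replace (2 * S n)%nat with (n + n + 2)%nat by lia.
replace (2 * n)%nat with (n + n)%nat by lia.
assert (h1 := one_minus_pow_neq_0 q (n + n + 1) hq).
assert (h2 := one_minus_pow_neq_0 q (m + m) hq).
assert (h4 := one_minus_pow_neq_0 q (n + n + m + m + 2) hq).
assert (ho := oddp_neq_0 q m hq).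
assert (he := evenp_neq_0 q n hq).
assert (hg := oddp_neq_0 q (S (m + n)) hq).
rewrite !Cpow_S, !Cpow_add_r in h1.
rewrite !Cpow_S, !Cpow_add_r in h2.
rewrite !Cpow_S, !Cpow_add_r in h4.
rewrite !Cpow_S, !Cpow_add_r.
set (om := oddp q m) in *; set (g := oddp q (S (m + n))) in *.
set (on := oddp q n); set (en := evenp q n) in *; set (em := evenp q m).
set (s := evenp q (m + n)).
set (z := q ^ (n * (2 * m + 1))); set (v := q ^ n) in *; set (w := q ^ m) in *.
clearbody z om g on en em s v w; simpl in *.
field; repeat split; solve_neq_0.
Qed.

(** * Boundary rows and columns of the WZ pairs *)

Lemma oddp_S_div (q : C) (n : nat) : (Cmod q < 1)%R ->
  oddp q n * / oddp q (S n) = / (1 - q ^ (2 * n + 1)).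
Proof.
intros hq; rewrite oddp_S.
assert (h := one_minus_pow_neq_0 q (n + n) hq).
assert (h' := oddp_neq_0 q n hq).
replace (2 * n + 1)%nat with (S (n + n)) by lia.
replace (q ^ S (n + n)) with (q * (q ^ n) ^ 2) in *
  by (rewrite (Cpow_S q (n + n)), Cpow_add_r; ring).
field; auto.
Qed.

(** Column 0 of [wz1_B] gives the accelerated series. In row 0 of [wz1_A] the prefactor is [(1 +
    q^2) (1 - q^2) / ((1 - q) * 2 (1 + q) (1 + q^2)) = 1/2], whence the factor 2 in the Lambert
    sum. *)
Lemma lambert_series_acceleration1 (q : C) : (Cmod q < 1)%R ->
  exists s : C,
    is_series
      (fun n : nat =>
         q ^ (2 * n * (n + 1)) * (1 + q ^ (2 * n + 2) - 2 * q ^ (4 * n + 3)) *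
         (qpoch (q ^ 2) (q ^ 2) n ^ 3 /
          (qpoch q (q ^ 2) (n + 1) ^ 3 * qpoch (- (1)) q (2 * n + 3)))) s /\
    is_series (fun n : nat => q ^ (2 * n) / (1 - q ^ (2 * n + 1)) ^ 2) (2 * s).
Proof.
intros hq.
destruct (wz_acceleration_bounded q
  (fun n k => (2 * n * (n + 1) + 2 * k * (2 * n + 1))%nat) (wz1_A q) (wz1_B q) hq)
  as (s & hA & hB).
- apply bounded_wz1_A, hq.
- apply bounded_wz1_B, hq.
- intros n k; nia.
- intros n k; apply wz_pair1, hq.
- exists s; split.
  + revert hB; apply Cseries_ext; intros n; unfold wz1_B.
    fold (evenp q n) (oddp q (n + 1)).
    replace (2 * n * (n + 1) + 2 * 0 * (2 * n + 1))%nat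
      with (2 * n * (n + 1))%nat by lia.
    replace (2 * 0 + 4 * n + 3)%nat with (4 * n + 3)%nat by lia.
    replace (S (n + 0)) with (S n) by lia.
    replace (n + 1)%nat with (S n) by lia.
    change (oddp q 0) with (RtoC 1).
    assert (h1 := oddp_neq_0 q (S n) hq).
    assert (h2 := qpoch_m1_neq_0 q (2 * n + 3) hq).
    field; auto.
  + apply (Cseries_scal (RtoC 2)) in hA; revert hA; apply Cseries_ext.
    intros k; unfold wz1_A.
    change (S (0 + k)) with (S k); rewrite oddp_S_div by exact hq.
    replace (2 * 0 * (0 + 1) + 2 * k * (2 * 0 + 1))%nat with (2 * k)%nat by lia.
    assert (h1 := one_minus_pow_neq_0 q (2 * k) hq).
    replace (S (2 * k)) with (2 * k + 1)%nat in h1 by lia.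
    set (x := q ^ (2 * k)); set (y := q ^ (2 * k + 1)) in *; clearbody x y.
    assert (h2 := one_minus_pow_neq_0 q 0 hq).
    assert (h3 := one_plus_pow_neq_0 q 0 hq).
    assert (h4 := one_plus_pow_neq_0 q 1 hq).
    assert (h5 : RtoC 2 <> 0) by (intros h; apply RtoC_inj in h; lra).
    simpl in *; unfold evenp, oddp; simpl.
    field; repeat split; solve_neq_0.
Qed.

(** Row 0 of [wz2_A] is the Lambert series itself. Column 0 of [wz2_B] carries [(q;q^2)_(n+1)^3 = (1
    - q)^3 (q^3;q^2)_n^3] in its denominator, while the stated summand has a single [1 - q]; this
    accounts for [(1 - q) ^ 2]. *)
Lemma lambert_series_acceleration2 (q : C) : (Cmod q < 1)%R ->
  exists s : C,
    is_series
      (fun n : nat =>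
         q ^ (n * (n + 1) / 2) * ((1 - q ^ (3 * n + 2)) / (1 - q)) *
         (qpoch q q n ^ 3 * qpoch (- q) q n / qpoch (q ^ 3) (q ^ 2) n ^ 3))
      ((1 - q) ^ 2 * s) /\
    is_series
      (fun n : nat => q ^ n * (1 + q ^ (2 * n + 1)) / (1 - q ^ (2 * n + 1)) ^ 2) s.
Proof.
intros hq.
destruct (wz_acceleration_bounded q
  (fun n k => (n * (n + 1) / 2 + k * (2 * n + 1))%nat) (wz2_A q) (wz2_B q) hq)
  as (s & hA & hB).
- apply bounded_wz2_A, hq.
- apply bounded_wz2_B, hq.
- intros n k; assert (h := triangular_ge n); nia.
- intros n k; apply wz_pair2, hq.
- exists s; split.
  + apply (Cseries_scal ((1 - q) ^ 2)) in hB; revert hB; apply Cseries_ext.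
    intros n; unfold wz2_B.
    assert (h0 := one_minus_neq_0 q hq).
    assert (h1 := oddp_neq_0 q (S n) hq).
    replace (S (n + 0)) with (S n) by lia.
    (* Peeling off the first factor leaves the parameter [q * q ^ 2], convertible with [q ^ 3]. *)
    assert (hO : oddp q (S n) = (1 - q) * qpoch (q ^ 3) (q ^ 2) n)
      by apply qpoch_S_l.
    rewrite hO in *; change (oddp q 0) with (RtoC 1).
    replace (n * (n + 1) / 2 + 0 * (2 * n + 1))%nat
      with (n * (n + 1) / 2)%nat by lia.
    replace (2 * 0 + 3 * n + 2)%nat with (3 * n + 2)%nat by lia.
    set (x := qpoch (q ^ 3) (q ^ 2) n) in *.
    assert (h2 : x <> 0) by (intros h; apply h1; rewrite h; ring).
    field; auto.
  + revert hA; apply Cseries_ext; intros k; unfold wz2_A.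
    change (S (0 + k)) with (S k); rewrite oddp_S_div by exact hq.
    change (0 * (0 + 1) / 2)%nat with 0%nat.
    replace (0 + k * (2 * 0 + 1))%nat with k by lia.
    replace (2 * k + 1 + 0)%nat with (2 * k + 1)%nat by lia.
    assert (h1 := one_minus_pow_neq_0 q (2 * k) hq).
    replace (S (2 * k)) with (2 * k + 1)%nat in h1 by lia.
    set (x := q ^ k); set (y := q ^ (2 * k + 1)) in *; clearbody x y.
    assert (h2 := one_minus_neq_0 q hq).
    unfold oddp; simpl.
    field; repeat split; solve_neq_0.
Qed.

(* The case [a = q^2], [b = c = d = q] of the nonterminating very-well-poised
   6-phi-5 sum in base [q^2]; row [m] of the WZ pair is the case
   [a = q^(2m+2)], which degenerates to its first term as [m] grows. *)
Lemma lambert_series_product (q s P1 P2 : C) : (Cmod q < 1)%R ->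
  is_series
    (fun n : nat => q ^ n * (1 + q ^ (2 * n + 1)) / (1 - q ^ (2 * n + 1)) ^ 2) s ->
  is_qpoch_inf (q ^ 2) (q ^ 2) P1 -> is_qpoch_inf q (q ^ 2) P2 -> P2 <> 0 ->
  s = P1 ^ 4 / P2 ^ 4.
Proof.
intros hq hs hP1 hP2 hP.
set (r := Cmod q) in *.
assert (hr : (0 <= r < 1)%R) by (split; [apply Cmod_ge_0 | exact hq]).
set (A := fun m n => q ^ (n * (2 * m + 1)) * wz3_A q (m, n)).
set (B := fun m n => q ^ (n * (2 * m + 1)) * wz3_B q (m, n)).
destruct (bounded_wz3_A q hq) as [cA hcA]; destruct (bounded_wz3_B q hq) as [cB hcB].
(* The exponent [n * (2 * m + 1)] is 0 in column 0, so there is no decay in [m] there. The bound is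
   used with [d = n] for convergence along a row, and with [d = m + n] for the terms of index
   [n + 1]. *)
assert (bound : forall (c : R) (x : C) (d e : nat), (Cmod x <= c)%R ->
          (d <= e)%nat -> (Cmod (q ^ e * x) <= c * r ^ d)%R).
{ intros c x d e hx hde; rewrite Cmod_mult, Cmod_pow, Rmult_comm.
  apply Rmult_le_compat; auto using Cmod_ge_0.
  - apply pow_le, hr.
  - apply Rpow_le_pow; [lra | exact hde]. }
assert (hA : forall m, is_series (A m) s).
{ induction m as [|m IH].
  - revert hs; apply Cseries_ext; intros n; unfold A, wz3_A.
    replace (n * (2 * 0 + 1))%nat with n by lia.
    (* Splitting the exponent factors [1 - q^(4n+2)] as [(1 - q^(2n+1)) (1 + q^(2n+1))], cancelling
       one of the three factors [1 - q^(2n+1)] below. *)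
    replace (4 * n + 2 + 2 * 0)%nat with ((2 * n + 1) + (2 * n + 1))%nat by lia.
    change (0 + n)%nat with n; change (evenp q 0) with (RtoC 1).
    change (oddp q 0) with (RtoC 1).
    rewrite (Cpow_add_r q (2 * n + 1) (2 * n + 1)).
    replace (oddp q n) with ((oddp q n * / oddp q (S n)) * oddp q (S n))
      by (field; apply oddp_neq_0, hq).
    rewrite oddp_S_div by exact hq.
    assert (h1 := one_minus_pow_neq_0 q (2 * n) hq).
    replace (S (2 * n)) with (2 * n + 1)%nat in h1 by lia.
    assert (h2 := oddp_neq_0 q (S n) hq); assert (h3 := evenp_neq_0 q n hq).
    field; auto.
  - destruct (ex_series_geometric_bound (A (S m)) cA r hr) as (s' & hs' & _).
    { intros n; apply bound; [apply hcA | nia]. }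
    enough (h : s - s' = 0).
    { replace s with s' by (rewrite <- (Cplus_0_r s'), <- h; ring); exact hs'. }
    rewrite (telescoping_step (A m) (A (S m)) (B m) s s'); auto.
    + unfold B, wz3_B; simpl; ring.
    + intros n; apply wz_pair3, hq.
    + apply (Clim_geometric _ _ cB r hr); intros n.
      replace (B m n - 0) with (B m n) by ring.
      apply bound; [apply hcB | nia]. }
(* Row [m] always sums to [s], and its terms beyond the first total at most
   [cA * r ^ m / (1 - r)]. *)
assert (hlim : filterlim (fun m => A m O) eventually (locally s)).
{ apply (Clim_geometric _ _ (cA / (1 - r)) r hr); intros m.
  destruct (ex_series_geometric_bound (fun n => A m (S n)) (cA * r ^ m) r hr)
    as (t & ht & hb).
  { intros n; rewrite Rmult_assoc, <- pow_add; apply bound; [apply hcA | nia]. }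
  assert (h : is_series (fun n => A m (S n)) (s - A m O)).
  { apply is_series_incr_1; change plus with Cplus.
    replace (s - A m O + A m O) with s by ring; apply hA. }
  assert (hst : s - A m O = t) by exact (Clim_unique _ _ _ h ht).
  replace (A m O - s) with (- t) by (rewrite <- hst; ring).
  rewrite Cmod_opp; eapply Rle_trans; [exact hb |]; right; field; lra. }
assert (hE : filterlim (evenp q) eventually (locally P1)) by exact hP1.
assert (hO : filterlim (oddp q) eventually (locally P2)) by exact hP2.
assert (hE' := proj2 (Clim_shift _ _) hE).
assert (hO' := proj2 (Clim_shift _ _) hO).
(* The closed form of [A m O] is used with denominators cleared, so that only limits of products are
   taken; division by [P2 ^ 4] comes last. *)
assert (h : s * (P2 ^ 3 * P2) = P1 * P1 ^ 3).
{ apply (Clim_unique (fun m => A m O * (oddp q (S m) ^ 3 * oddp q m))).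
  - apply Clim_mult; [exact hlim |]; apply Clim_mult; [| exact hO].
    apply (Clim_pow (fun m => oddp q (S m))), hO'.
  - apply (filterlim_ext (fun m => evenp q (S m) * evenp q m ^ 3)).
    + intros m; rewrite evenp_S; unfold A, wz3_A.
      replace (m + 0)%nat with m by lia.
      change (evenp q 0) with (RtoC 1); change (oddp q 0) with (RtoC 1).
      replace (4 * 0 + 2 + 2 * m)%nat with (m + m + 2)%nat by lia.
      rewrite !Cpow_add_r; simpl.
      assert (h1 := oddp_neq_0 q (S m) hq); assert (h2 := oddp_neq_0 q m hq).
      field; auto.
    + apply Clim_mult; [exact hE' | apply Clim_pow, hE]. }
replace (P1 ^ 4) with (P1 * P1 ^ 3) by (simpl; ring); rewrite <- h.
field; exact hP.
Qed.

Theorem theorem1p2 (q : C) (hq : (Cmod q < 1)%R) :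
  (exists S1 S2 : C,
     is_series
       (fun n : nat =>
          q ^ (2 * n * (n + 1)) * (1 + q ^ (2 * n + 2) - 2 * q ^ (4 * n + 3)) *
          (qpoch (q ^ 2) (q ^ 2) n ^ 3 /
           (qpoch q (q ^ 2) (n + 1) ^ 3 * qpoch (- (1)) q (2 * n + 3)))) S1 /\
     is_series (fun n : nat => q ^ (2 * n) / (1 - q ^ (2 * n + 1)) ^ 2) S2 /\
     S1 = 1 / 2 * S2) /\
  (exists S P1 P2 : C,
     is_series
       (fun n : nat =>
          q ^ (n * (n + 1) / 2) * ((1 - q ^ (3 * n + 2)) / (1 - q)) *
          (qpoch q q n ^ 3 * qpoch (- q) q n / qpoch (q ^ 3) (q ^ 2) n ^ 3)) S /\
     is_qpoch_inf (q ^ 2) (q ^ 2) P1 /\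
     is_qpoch_inf q (q ^ 2) P2 /\
     P2 <> 0 /\
     S = (1 - q) ^ 2 * (P1 ^ 4 / P2 ^ 4)).
Proof.
split.
- destruct (lambert_series_acceleration1 q hq) as (s & h1 & h2).
  exists s, (2 * s); repeat split; [exact h1 | exact h2 |].
  field; intros h; apply RtoC_inj in h; lra.
- destruct (lambert_series_acceleration2 q hq) as (s & h1 & h2).
  assert (hq2 := Cmod_pow_lt_1 q 1 hq).
  destruct (ex_qpoch_inf (q ^ 2) (q ^ 2) hq2 hq2) as (P1 & hP1 & _).
  destruct (ex_qpoch_inf q (q ^ 2) hq hq2) as (P2 & hP2 & hP).
  exists ((1 - q) ^ 2 * s), P1, P2; repeat split; auto.
  rewrite (lambert_series_product q s P1 P2); auto.
Qed.
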